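(* Assume we are given $S\in\mathbb{R}^{d\times m_s}$, $R^*\in\mathbb{R}^{d\times 2np^*}$ and $C^*\in\mathbb{R}^{m\times 2np^*}$ with $r_C:=\mathrm{rank}(C^* )\leq m$. Let $\mathcal{U}^*\Sigma^*(\mathcal{V}^* )^\top$ be the compact singular value decomposition of $C^*$, with $\mathcal{U}^*\in\mathbb{R}^{m\times r_C}$, $\Sigma^*\in\mathbb{R}^{r_C\times r_C}$, $\mathcal{V}^*\in\mathbb{R}^{2np^*\times r_C}$. Let $\mathcal{O}(\alpha,\beta):=\lVert S^\top R^*+\alpha\beta^\top C^*\rVert_F^2$ and $$\mathbb{V}_r:=\{(\alpha,\beta)\in\mathbb{R}^{m_s\times r}\times\mathbb{R}^{m\times r}:\ \mathrm{rank}(\alpha)=\mathrm{rank}(\beta)=r\}.$$ Then, for any $1\leq r\leq\mathrm{rank}(S^\top R^*\mathcal{V}^* )\leq r_C$, the solution of the minimization problem $\min_{(\alpha,\beta)\in\mathbb{V}_r}\mathcal{O}(\alpha,\beta)$ is $$\alpha\beta^\top=-(S^\top R^*\mathcal{V}^* )_r(\Sigma^* )^{-1}(\mathcal{U}^* )^\top,$$ where $(S^\top R^*\mathcal{V}^* )_r$ denotes the $r$-truncated SVD of $S^\top R^*\mathcal{V}^*$. Moreover, it holds $$\min_{(\alpha,\beta)\in\mathbb{V}_r}\mathcal{O}(\alpha,\beta)=\lVert S^\top R^*\rVert_F^2-\sum_{i=1}^r\overline{\sigma}_i^2,$$ where $\overline{\sigma}_1\geq\dots\geq\overline{\sigma}_r$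 are the $r$ dominant singular values of $S^\top R^*\mathcal{V}^*\in\mathbb{R}^{m_s\times r_C}$. In particular, if $r=\mathrm{rank}(S^\top R^*\mathcal{V}^* )$, then $\alpha\beta^\top=-S^\top R^*(C^* )^\dagger$ and $$\min_{(\alpha,\beta)\in\mathbb{V}_r}\mathcal{O}(\alpha,\beta)=\lVert S^\top R^*\rVert_F^2-\lVert S^\top R^*\mathcal{V}^*\rVert_F^2.$$
   Context: Here $d,m,m_s,n,p^*$ are positive integers with $m\leq m_s\leq d$, and $S=[\mathbf{e}_{i_1}|\dots|\mathbf{e}_{i_{m_s}}]\in\mathbb{R}^{d\times m_s}$, where $\mathbf{e}_i$ is the $i$th unit vector of $\mathbb{R}^d$ and $\{i_1,\dots,i_{m_s}\}\subset\{1,\dots,d\}$ is a set of $m_s$ (distinct) sample indices. $\lVert\cdot\rVert_F$ is the Frobenius norm and $(\cdot)^\dagger$ the Moore–Penrose pseudoinverse. The compact SVD of a matrix keeps only the nonzero singular values, so that $\Sigma^*$ is diagonal with positive entries and $\mathcal{U}^*,\mathcal{V}^*$ have orthonormal columns. The $r$-truncated SVD of a matrix $B=\sum_i\overline{\sigma}_i\overline{u}_i\overline{v}_i^\top$ (with singular values in non-increasing order) is $(B)_r:=\sum_{i=1}^r\overline{\sigma}_i\overline{u}_i\overline{v}_i^\top$.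
   Formalization: ''The solution'' is not unique as worded: a minimizer's αβᵀ is shown to equal the formula only when r_C = m (otherwise only after right multiplication by C* ), and, if singular values tie, for some choice of the SVD defining the r-truncated SVD; every αβᵀ given by the formula is shown optimal. *)

(* Defs.v *)
From HB Require Import structures.
From mathcomp Require Import all_boot all_order all_algebra.
From mathcomp Require Import classical_sets reals.

Set Implicit Arguments.
Unset Strict Implicit.
Unset Printing Implicit Defensive.

Import Order.TTheory GRing.Theory Num.Theory.
Local Open Scope ring_scope.

Section Definitions.
Variable R : realType.

Definition frobenius_norm p q (A : 'M[R]_(p, q)) : R :=
  Num.sqrt (\sum_i \sum_j A i j ^+ 2).

(* [e_(idx 0) | ... | e_(idx (ms - 1))] *)
Definition selection_mx d ms (idx : 'I_ms -> 'I_d) : 'M[R]_(d, ms) :=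
  \matrix_(i, j) (i == idx j)%:R.

(* The inner dimension k is free, so this covers the compact SVD, where
   k = \rank A, and the thin SVD, where k = minn p q. No order is imposed on
   the singular values s. *)
Definition is_svd p q k (A : 'M[R]_(p, q))
    (U : 'M[R]_(p, k)) (s : 'rV[R]_k) (V : 'M[R]_(q, k)) : Prop :=
  [/\ U^T *m U = 1%:M, V^T *m V = 1%:M,
      (forall i, 0 <= s 0 i) & A = U *m diag_mx s *m V^T].

Definition is_compact_svd p q k (A : 'M[R]_(p, q))
    (U : 'M[R]_(p, k)) (s : 'rV[R]_k) (V : 'M[R]_(q, k)) : Prop :=
  is_svd A U s V /\ forall i, 0 < s 0 i.

Definition is_ordered_svd p q k (A : 'M[R]_(p, q))
    (U : 'M[R]_(p, k)) (s : 'rV[R]_k) (V : 'M[R]_(q, k)) : Prop :=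
  is_svd A U s V /\ forall i j : 'I_k, (i <= j)%N -> s 0 j <= s 0 i.

(* The matrix (A)_r computed from a given ordered SVD of A; when the r-th and
   (r+1)-st singular values coincide, it depends on the choice of the SVD. *)
Definition truncated_svd p q k (r : nat)
    (U : 'M[R]_(p, k)) (s : 'rV[R]_k) (V : 'M[R]_(q, k)) : 'M[R]_(p, q) :=
  \sum_(i < k | (i < r)%N) s 0 i *: (col i U *m (col i V)^T).

(* The four Penrose conditions, which determine X uniquely. *)
Definition is_pinv p q (A : 'M[R]_(p, q)) (X : 'M[R]_(q, p)) : Prop :=
  [/\ A *m X *m A = A, X *m A *m X = X,
      (A *m X)^T = A *m X & (X *m A)^T = X *m A].

Definition rank_pairs ms m r : set ('M[R]_(ms, r) * 'M[R]_(m, r)) :=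
  [set ab | \rank ab.1 = r /\ \rank ab.2 = r].

Definition objective d ms m N r (S : 'M[R]_(d, ms)) (Rs : 'M[R]_(d, N))
    (C : 'M[R]_(m, N)) (ab : 'M[R]_(ms, r) * 'M[R]_(m, r)) : R :=
  frobenius_norm (S^T *m Rs + ab.1 *m ab.2^T *m C) ^+ 2.

Definition is_argmin (T : Type) (D : set T) (f : T -> R) (x : T) : Prop :=
  D x /\ forall y, D y -> f x <= f y.

Definition is_min_value (T : Type) (D : set T) (f : T -> R) (v : R) : Prop :=
  exists2 x, is_argmin D f x & v = f x.

Lemma pinv_unique p q (A : 'M[R]_(p, q)) (X Y : 'M[R]_(q, p)) :
  is_pinv A X -> is_pinv A Y -> X = Y.
Proof.
case=> AXA XAX sAX sXA [AYA YAY sAY sYA].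
have eAX : A *m X = A *m Y.
  by rewrite -sAX -{1}AYA -(mulmxA _ A X) trmx_mul sAX sAY mulmxA AXA.
have eXA : X *m A = Y *m A.
  by rewrite -sXA -{1}AYA -(mulmxA A Y A) mulmxA trmx_mul sXA sYA -mulmxA
    (mulmxA A X A) AXA.
by rewrite -XAX eXA -mulmxA eAX mulmxA YAY.
Qed.

Lemma compact_svd_pinv p q k (A : 'M[R]_(p, q))
    (U : 'M[R]_(p, k)) (s : 'rV[R]_k) (V : 'M[R]_(q, k)) :
  is_compact_svd A U s V -> is_pinv A (V *m invmx (diag_mx s) *m U^T).
Proof.
case=> -[UU VV _ ->] s_gt0.
have Du : diag_mx s \in unitmx.
  rewrite unitmxE det_diag unitfE; apply/prodf_neq0 => i _.
  by rewrite gt_eqF.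
have AX : U *m diag_mx s *m V^T *m (V *m invmx (diag_mx s) *m U^T) = U *m U^T.
  by rewrite !mulmxA -(mulmxA _ V^T V) VV mulmx1 mulmxK.
have XA : V *m invmx (diag_mx s) *m U^T *m (U *m diag_mx s *m V^T) = V *m V^T.
  by rewrite !mulmxA -(mulmxA _ U^T U) UU mulmx1 mulmxKV.
split; rewrite ?AX ?XA ?trmx_mul ?trmxK //.
- by rewrite !mulmxA -(mulmxA _ U^T U) UU mulmx1.
- by rewrite !mulmxA -(mulmxA _ V^T V) VV mulmx1.
Qed.

End Definitions.

(* Main.v *)
(* With Z = - alpha beta^T U Sigma, the objective equals
   |S^T Rs|^2 - |B|^2 + |B - Z|^2, so the problem is the best approximation of B
   in rank r (Eckart-Young), together with a description of all minimizers.
   If P is the orthogonal projection onto the row space of Z, then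
   |B - Z|^2 = |B P - Z|^2 + |B|^2 - |B P|^2, and |B P|^2 is the sum of the
   s_i^2 with weights w_i = |P v_i|^2 in [0, 1] of total at most r. In the
   equality case Z = B P and W = V^T P V is a projection of rank r that agrees
   with pid_mx r wherever s_i differs from s_(r-1), so W = T pid_mx r T^T for an
   orthogonal T commuting with diag_mx s; then (U T, s, V T) is an ordered SVD
   of B whose truncation is Z. *)
Require Import Defs.
From mathcomp Require Import all_boot all_order all_algebra.
From mathcomp Require Import classical_sets reals.
From mathcomp Require Import ring lra.

Set Implicit Arguments.
Unset Strict Implicit.
Unset Printing Implicit Defensive.

Import Order.TTheory GRing.Theory Num.Theory.
Local Open Scope ring_scope.

(** * Traces, row-space projections and rank factorizations *)

Lemma trace_mul_trE (R : realType) p q (A : 'M[R]_(p, q)) :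
  \tr (A *m A^T) = \sum_i \sum_j A i j ^+ 2.
Proof.
by apply: eq_bigr => i _; rewrite mxE; apply: eq_bigr => j _; rewrite mxE expr2.
Qed.

Lemma trace_mul_tr_ge0 (R : realType) p q (A : 'M[R]_(p, q)) :
  0 <= \tr (A *m A^T).
Proof.
by rewrite trace_mul_trE; do 2!apply: sumr_ge0 => ? _; rewrite sqr_ge0.
Qed.

Lemma trace_mul_tr_eq0 (R : realType) p q (A : 'M[R]_(p, q)) :
  \tr (A *m A^T) = 0 -> A = 0.
Proof.
rewrite trace_mul_trE => A0; apply/matrixP => i j; rewrite mxE.
have row_ge0 (l : 'I_p) : 0 <= \sum_j A l j ^+ 2.
  by apply: sumr_ge0 => ? _; rewrite sqr_ge0.
have Ai0 : \sum_j A i j ^+ 2 = 0 by apply: (psumr_eq0P _ A0).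
by apply/eqP; rewrite -sqrf_eq0; apply/eqP;
   apply: (psumr_eq0P _ Ai0) => // l _; rewrite sqr_ge0.
Qed.

Lemma frobenius_norm_sqr (R : realType) p q (A : 'M[R]_(p, q)) :
  frobenius_norm A ^+ 2 = \tr (A *m A^T).
Proof. by rewrite sqr_sqrtr -trace_mul_trE ?trace_mul_tr_ge0. Qed.

(** If [K *m A *m A^T = 0], then [K *m A] has Frobenius norm zero, so [K = 0] because the rows of
    [A] are independent. *)
Lemma gram_unitmx (R : realType) p q (A : 'M[R]_(p, q)) :
  row_free A -> A *m A^T \in unitmx.
Proof.
move=> Afree; rewrite -row_free_unit -kermx_eq0.
have: kermx (A *m A^T) *m A = 0.
  apply: trace_mul_tr_eq0.
  by rewrite trmx_mul mulmxA -(mulmxA _ A) mulmx_ker mul0mx mxtrace0.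
by rewrite -[0](mul0mx _ A) => /(row_free_inj Afree) ->.
Qed.

(** For a row basis [M] of [Z], the projection is [M^T (M M^T)^-1 M]. By cyclicity, its trace is
    that of an identity matrix of size [\rank Z]. *)
Lemma row_space_projection (R : realType) p q (Z : 'M[R]_(p, q)) :
  exists P : 'M[R]_q,
    [/\ P^T = P, P *m P = P, Z *m P = Z & \tr P = (\rank Z)%:R].
Proof.
have := gram_unitmx (row_base_free Z).
move: (row_base Z) (col_base Z) (mulmx_base Z) => M L LM Mu.
exists (M^T *m invmx (M *m M^T) *m M); split.
- by rewrite !trmx_mul trmx_inv trmx_mul !trmxK mulmxA.
- by rewrite !mulmxA -(mulmxA _ M M^T) mulmxKV.
- by rewrite -{1}LM !mulmxA -(mulmxA _ M M^T) mulmxK.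
- by rewrite mxtrace_mulC mulmxA mulmxV // mxtrace1.
Qed.

Lemma rank_factorization (F : fieldType) p q r (X : 'M[F]_(p, q)) :
  \rank X = r ->
  exists2 ab : 'M[F]_(p, r) * 'M[F]_(q, r),
    \rank ab.1 = r /\ \rank ab.2 = r & ab.1 *m ab.2^T = X.
Proof.
move=> <-; exists (col_base X, (row_base X)^T) => /=.
  by rewrite mxrank_tr; split; apply/eqP;
    [exact: col_base_full | exact: row_base_free].
by rewrite trmxK mulmx_base.
Qed.

(** * Reflections and diagonalization of projections *)

(* Householder reflection along [x - y]. *)
Lemma reflection_swap (R : realType) k (x y : 'cV[R]_k) :
  x^T *m x = y^T *m y ->
  exists H : 'M[R]_k,
    [/\ H^T = H, H *m H = 1%:M, H *m x = y
      & forall l (Z : 'M[R]_(k, l)), (x - y)^T *m Z = 0 -> H *m Z = Z].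
Proof.
move=> xy; have [->|neq] := eqVneq x y.
  exists 1%:M; split; rewrite ?trmx1 ?mul1mx //.
  by move=> l Z _; rewrite mul1mx.
set w := x - y.
have [a xx] : exists a, x^T *m x = a%:M by eexists; exact: mx11_scalar.
have [b xy'] : exists b, y^T *m x = b%:M by eexists; exact: mx11_scalar.
have yx : x^T *m y = b%:M.
  by rewrite -[LHS]trmxK trmx_mul trmxK xy' tr_scalar_mx.
have wx : w^T *m x = (a - b)%:M.
  by rewrite linearB /= mulmxBl xx xy' -raddfB.
have ww : w^T *m w = (2 * (a - b))%:M.
  rewrite mulmxBr wx linearB /= mulmxBl yx -xy xx -!raddfB.
  by congr (_%:M); ring.
have c0 : a - b != 0.
  apply: contra_neq neq => ab; apply/eqP; rewrite -subr_eq0 -/w -[w]trmxK.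
  rewrite (@trace_mul_tr_eq0 _ _ _ w^T) ?trmx0 // trmxK ww ab mulr0.
  by rewrite raddf0 mxtrace0.
(* Since [w^T *m w] is [2 * (a - b)], this is the usual reflection [1 - 2 w w^T / |w|^2]. *)
exists (1%:M - (a - b)^-1 *: (w *m w^T)); split.
- by rewrite linearB linearZ /= trmx1 trmx_mul trmxK.
- rewrite mulmxBl mul1mx -scalemxAl mulmxBr mulmx1 -scalemxAr -mulmxA.
  rewrite (mulmxA w^T) ww mul_scalar_mx -scalemxAr.
  by apply/matrixP => i j; rewrite !mxE; field.
- rewrite mulmxBl mul1mx -scalemxAl -mulmxA wx mul_mx_scalar scalerA.
  by rewrite mulVf ?scale1r ?subKr.
- move=> l Z wZ; rewrite mulmxBl mul1mx -scalemxAl -mulmxA wZ mulmx0.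
  by rewrite scaler0 subr0.
Qed.

Lemma pid_mxS (R : pzSemiRingType) k (i : 'I_k) :
  pid_mx i.+1 = pid_mx i + delta_mx i 0 *m (delta_mx i (0 : 'I_1))^T
    :> 'M[R]_k.
Proof.
apply/matrixP => a b; rewrite trmx_delta mul_delta_mx !mxE -val_eqE /= ltnS.
have [->|ab] /= := eqVneq (a : nat) b; last first.
  rewrite add0r; case: eqVneq => //= ai; case: eqVneq => // bi.
  by rewrite ai bi eqxx in ab.
by rewrite -!val_eqE /= andbb; case: (ltngtP (b : nat)); rewrite ?addr0 ?add0r.
Qed.

Lemma pid_mx_delta (R : pzSemiRingType) k (i : 'I_k) :
  pid_mx i *m delta_mx i 0 = 0 :> 'cV[R]_k.
Proof.
apply/matrixP => a b; rewrite !mxE big1 // => l _; rewrite !mxE.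
have [->|li] := eqVneq l i; last by rewrite mulr0.
by case: eqVneq => [->|]; rewrite ?ltnn mul0r.
Qed.

Lemma trace_pid_mx (R : pzSemiRingType) k r : (r <= k)%N ->
  \tr (pid_mx r : 'M[R]_k) = r%:R.
Proof.
elim: r => [|r IHr] rk; first by rewrite pid_mx_0 mxtrace0.
rewrite (pid_mxS R (Ordinal rk)) mxtraceD IHr 1?ltnW // trmx_delta mul_delta_mx.
rewrite -natr1; congr (_ + _); rewrite /mxtrace (bigD1 (Ordinal rk)) //=.
by rewrite mxE eqxx big1 ?addr0 // => i /negPf ir; rewrite mxE ir.
Qed.

(* T is a product of Householder reflections. Each one sends the next basis
   vector to a unit vector of the range of W orthogonal to the previous ones;
   both vectors lie in the kernel of diag_mx nu, so diag_mx nu is unaffected. *)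
Lemma projection_diagonalization (R : realType) k r (nu : 'rV[R]_k)
    (W : 'M[R]_k) :
  (r <= k)%N -> W^T = W -> W *m W = W -> \tr W = r%:R ->
  (forall i j : 'I_k, (i <= j)%N -> (j < r)%N -> nu 0 i = 0 -> nu 0 j = 0) ->
  diag_mx nu *m W = diag_mx nu *m pid_mx r ->
  exists T : 'M[R]_k,
    [/\ T^T *m T = 1%:M, diag_mx nu *m T = diag_mx nu
      & W = T *m pid_mx r *m T^T].
Proof.
move=> rk Wsym Widem trW nu0 nuW; set N := diag_mx nu.
have Nsym : N^T = N by rewrite tr_diag_mx.
have WN : W *m N = pid_mx r *m N.
  by rewrite -[LHS]trmxK trmx_mul Nsym Wsym nuW trmx_mul Nsym tr_pid_mx.
(* Invariant: [T] is orthogonal, leaves [N] unchanged, and has its first [n] columns in the range of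
   [W]. *)
have partial n : (n <= r)%N -> exists T,
    [/\ T^T *m T = 1%:M, N *m T = N
      & W *m T *m pid_mx n = T *m pid_mx n :> 'M_k].
  elim: n => [|n IHn] nr.
    by exists 1%:M; rewrite trmx1 !mulmx1 pid_mx_0 !mulmx0.
  have [T [TT NT WT]] := IHn (ltnW nr).
  pose i := Ordinal (leq_trans nr rk); pose e : 'cV[R]_k := delta_mx i 0.
  have TTt : T *m T^T = 1%:M by apply/mulmx1C.
  have TN : T *m N = N.
    rewrite -{2}[N]mul1mx -TTt -mulmxA; congr (_ *m _).
    by rewrite -{2}Nsym -trmx_mul NT Nsym.
  have pidS : pid_mx n.+1 = pid_mx n + e *m e^T := pid_mxS R i.
  have Ne : N *m e = nu 0 i *: e.
    by rewrite mul_diag_mx; apply/matrixP => a b; rewrite !mxE;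
       case: eqVneq => [->|]; rewrite ?mulr0.
  have pide : pid_mx r *m e = e.
    rewrite -colE; apply/matrixP => a b; rewrite !mxE ord1 andbT.
    by rewrite -val_eqE /=; case: eqVneq => [->|//]; rewrite nr.
  (* If [nu 0 i] is nonzero, [T] already works: [e] is a multiple of [N *m e], [T] fixes the range
     of [N], and [W] acts there as [pid_mx r]. *)
  have [nui|nui] := eqVneq (nu 0 i) 0; last first.
    exists T; split => //; rewrite pidS !mulmxDr WT !mulmxA.
    have -> : e = (nu 0 i)^-1 *: (N *m e).
      by rewrite Ne scalerA mulVf ?scale1r.
    rewrite -!scalemxAr !mulmxA -(mulmxA W) TN WN -(mulmxA _ N) Ne.
    by rewrite -scalemxAr pide.
  (* [W'] is [W] in the basis given by [T]. [G] projects onto the part of its range orthogonal to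
     the first [n] basis vectors. *)
  set W' := T^T *m W *m T; set G := W' - pid_mx n.
  have W'sym : W'^T = W' by rewrite !trmx_mul trmxK Wsym mulmxA.
  have W'idem : W' *m W' = W'.
    by rewrite /W' !mulmxA -(mulmxA _ T T^T) TTt mulmx1 -(mulmxA T^T) Widem.
  have W'n : W' *m pid_mx n = pid_mx n :> 'M_k.
    by rewrite /W' -!mulmxA (mulmxA W) WT mulmxA TT mul1mx.
  have nW' : pid_mx n *m W' = pid_mx n :> 'M_k.
    by rewrite -W'sym -(tr_pid_mx R k k n) -trmx_mul W'n.
  have nle : (n <= k)%N by exact: leq_trans (ltnW nr) rk.
  (* Here [nu] vanishes at [i], whose value is [n], hence at every index from [n] to [r - 1]. *)
  have Nn : N *m pid_mx n = N *m pid_mx r :> 'M_k.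
    rewrite !mul_diag_mx; apply/matrixP => a b; rewrite !mxE.
    have [ab|] := eqVneq (a : nat) b; last by rewrite mulr0.
    have [an|na] := ltnP a n; first by rewrite (ltn_trans an nr).
    have [ar|//] := ltnP a r.
    by rewrite (nu0 i a) ?mul0r.
  have W'G : W' *m G = G by rewrite mulmxBr W'idem W'n.
  have nG : pid_mx n *m G = 0 :> 'M_k
    by rewrite mulmxBr nW' pid_mx_id // subrr.
  have NTt : N *m T^T = N by rewrite -{1}Nsym -trmx_mul TN Nsym.
  have Nr : N *m pid_mx r = pid_mx r *m N :> 'M_k.
    rewrite mul_diag_mx mul_mx_diag; apply/matrixP => b c; rewrite !mxE mulrC.
    by case: (eqVneq (b : nat) c) => [/val_inj->|]; rewrite ?mulr0 ?mul0r.
  have NG : N *m G = 0.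
    by rewrite mulmxBr Nn /W' !mulmxA NTt nuW Nr -mulmxA NT subrr.
  (* The trace of [G] is [r - n], which is positive; a nonzero column of [G], normalized, will be
     the target of the reflection. *)
  have G0 : G != 0.
    apply/eqP => /(congr1 mxtrace)/eqP.
    rewrite mxtrace0 linearB /= mxtrace_mulC mulmxA TTt mul1mx trW.
    by rewrite trace_pid_mx // subr_eq0 eqr_nat gtn_eqF.
  have [l Gl0] : exists l, col l G != 0.
    apply/existsP; apply: contraT; rewrite negb_exists => /forallP Gl.
    case/eqP: G0; apply/matrixP => a b; have := Gl b; rewrite negbK => /eqP.
    by move/colP/(_ a); rewrite !mxE.
  set x0 := col l G; rewrite -/x0 in Gl0; set a := \tr (x0^T *m x0^T^T).
  have a_gt0 : 0 < a.
    rewrite lt0r trace_mul_tr_ge0 andbT.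
    apply: contraNneq Gl0 => a0; rewrite -[x0]trmxK.
    by rewrite (@trace_mul_tr_eq0 _ _ _ x0^T) ?trmx0.
  pose x := (Num.sqrt a)^-1 *: x0.
  have Gx q (M : 'M_(q, k)) : M *m x = (Num.sqrt a)^-1 *: col l (M *m G).
    by rewrite /x /x0 -scalemxAr !colE mulmxA.
  have Nx : N *m x = 0 by rewrite Gx NG col0 scaler0.
  have nx : pid_mx n *m x = 0 :> 'cV_k by rewrite Gx nG col0 scaler0.
  have W'x : W' *m x = x by rewrite Gx W'G.
  have ee : e^T *m e = 1%:M.
    rewrite trmx_delta mul_delta_mx; apply/matrixP => ? ?.
    by rewrite !ord1 !mxE.
  have exx : e^T *m e = x^T *m x.
    rewrite ee /x linearZ /= [(_ *: x0)^T]linearZ /= -scalemxAl scalerA.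
    rewrite -invfM -expr2 sqr_sqrtr ?ltW // [x0^T *m x0]mx11_scalar.
    rewrite -trace_mx11 -{2}[x0]trmxK -/a.
    by rewrite scale_scalar_mx mulVf ?gt_eqF.
  (* [H] sends [e] to [x]. It fixes [N] and [pid_mx n] because both annihilate [e - x]. *)
  have [H [Hsym HH Hex Hfix]] := reflection_swap exx.
  have HN : H *m N = N.
    apply: Hfix; rewrite -[LHS]trmxK trmx_mul trmxK Nsym mulmxBr Nx Ne nui.
    by rewrite scale0r subrr trmx0.
  have Hn : H *m pid_mx n = pid_mx n :> 'M_k.
    apply: Hfix; rewrite -[LHS]trmxK trmx_mul trmxK tr_pid_mx mulmxBr nx.
    by rewrite (pid_mx_delta _ i) subrr trmx0.
  exists (T *m H); split.
  - by rewrite trmx_mul mulmxA -(mulmxA _ T^T) TT mulmx1 Hsym HH.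
  - by rewrite mulmxA NT -[N *m H]trmxK trmx_mul Hsym Nsym HN Nsym.
  have WTW : W *m T = T *m W' by rewrite /W' !mulmxA TTt mul1mx.
  rewrite mulmxA WTW -!(mulmxA T); congr (T *m _).
  rewrite -mulmxA pidS (mulmxDr H) Hn mulmxDr W'n; congr (_ + _).
  by rewrite !(mulmxA H) Hex mulmxA W'x.
have [T [TT NT WT]] := partial r (leqnn r).
exists T; split => //; set E := T *m pid_mx r *m T^T.
have Esym : E^T = E by rewrite !trmx_mul trmxK tr_pid_mx mulmxA.
have WE : W *m E = E by rewrite /E !mulmxA WT.
have EW : E *m W = E by rewrite -{1}Esym -Wsym -trmx_mul WE.
have EE : E *m E = E.
  by rewrite /E !mulmxA -(mulmxA _ T^T T) TT mulmx1 -(mulmxA T) pid_mx_id.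
have trE : \tr E = r%:R.
  by rewrite /E mxtrace_mulC mulmxA TT mul1mx trace_pid_mx.
(* [W] and [E] are projections of trace [r] with [W *m E = E], so [(W - E) (W - E)^T = W - E] has
   trace zero. *)
apply/eqP; rewrite -subr_eq0; apply/eqP/trace_mul_tr_eq0.
rewrite linearB /= Wsym Esym mulmxBl !mulmxBr WE EW EE Widem subrr subr0.
by rewrite linearB /= trW trE subrr.
Qed.

(** * Singular value decompositions and their truncations *)

Lemma gram_diag_ge0 (R : realType) p q (A : 'M[R]_(p, q)) i :
  0 <= (A^T *m A) i i.
Proof.
by rewrite mxE sumr_ge0 // => j _; rewrite mxE -expr2 sqr_ge0.
Qed.

Lemma diag_mx_pid (R : pzRingType) k r (s : 'rV[R]_k) :
  diag_mx s *m pid_mx r = diag_mx (\row_i ((i < r)%:R * s 0 i)) :> 'M_k.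
Proof.
rewrite mul_diag_mx; apply/matrixP => i j; rewrite !mxE val_eqE.
by case: eqVneq => [->|]; rewrite ?mulr0 //=; case: (j < r)%N;
   rewrite ?mul1r ?mulr1 ?mul0r ?mulr0.
Qed.

Lemma truncated_svdE (R : realType) p q k r (U : 'M[R]_(p, k)) (s : 'rV[R]_k)
    (V : 'M[R]_(q, k)) :
  truncated_svd r U s V = U *m diag_mx s *m pid_mx r *m V^T.
Proof.
rewrite -(mulmxA U) diag_mx_pid mul_mx_diag; apply/matrixP => a b.
rewrite /truncated_svd summxE mxE big_mkcond; apply: eq_bigr => i _.
rewrite !mxE; case: (i < r)%N; rewrite ?mul1r ?mul0r ?mulr0 ?mul0r //.
by rewrite big_ord1 !mxE mulrCA mulrA.
Qed.

Lemma trace_mul_tr_svd (R : realType) p q k (U : 'M[R]_(p, k)) (s : 'rV[R]_k)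
    (V : 'M[R]_(q, k)) (A : 'M[R]_(p, q)) :
  U^T *m U = 1%:M -> V^T *m V = 1%:M -> A = U *m diag_mx s *m V^T ->
  \tr (A *m A^T) = \sum_i s 0 i ^+ 2.
Proof.
move=> UU VV ->; rewrite !trmx_mul trmxK tr_diag_mx !mulmxA.
rewrite -(mulmxA _ V^T V) VV mulmx1 mxtrace_mulC !mulmxA UU mul1mx.
by rewrite mulmx_diag mxtrace_diag; apply: eq_bigr => i _; rewrite mxE.
Qed.

(** A zero at position [i] forces zeros at all later positions, and then [B] has rank at most
    [i]. *)
Lemma ordered_svd_gt0 (R : realType) p q k (B : 'M[R]_(p, q))
    (U : 'M[R]_(p, k)) (s : 'rV[R]_k) (V : 'M[R]_(q, k)) (i : 'I_k) :
  is_ordered_svd B U s V -> (i < \rank B)%N -> 0 < s 0 i.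
Proof.
case=> -[_ _ s_ge0 ->] s_le; rewrite lt0r s_ge0 andbT; apply: contraTneq => si0.
rewrite -leqNgt.
have -> : diag_mx s = diag_mx s *m pid_mx i.
  rewrite diag_mx_pid; congr diag_mx; apply/rowP => j; rewrite !mxE.
  case: ltnP => ij; rewrite ?mul1r // mul0r; apply/eqP.
  by rewrite eq_le s_ge0 -si0 s_le.
rewrite -!mulmxA; apply: leq_trans (mxrankM_maxr _ _) _.
apply: leq_trans (mxrankM_maxr _ _) _; apply: leq_trans (mxrankM_maxl _ _) _.
by rewrite rank_pid_mx // ltnW.
Qed.

(** For the lower bound, multiplying by [U^T], [V] and the inverses of the singular values recovers
    [pid_mx r]. Only the inverses at indices below [r] matter, and there the values are positive. *)
Lemma rank_truncated_svd (R : realType) p q k r (B : 'M[R]_(p, q))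
    (U : 'M[R]_(p, k)) (s : 'rV[R]_k) (V : 'M[R]_(q, k)) :
  is_ordered_svd B U s V -> (r <= \rank B)%N ->
  \rank (truncated_svd r U s V) = r.
Proof.
move=> svdB rB; have [[UU VV _ eB] _] := svdB.
have rk : (r <= k)%N.
  apply: leq_trans rB _; rewrite eB -mulmxA.
  exact: leq_trans (mxrankM_maxl _ _) (rank_leq_col _).
apply/eqP; rewrite eqn_leq truncated_svdE; apply/andP; split.
  apply: leq_trans (mxrankM_maxl _ _) _; apply: leq_trans (mxrankM_maxr _ _) _.
  by rewrite rank_pid_mx.
have E : diag_mx (\row_i (s 0 i)^-1) *m U^T *m
    (U *m diag_mx s *m pid_mx r *m V^T) *m V = pid_mx r :> 'M_k.
  rewrite -!mulmxA VV mulmx1 (mulmxA U^T) UU mul1mx diag_mx_pid mulmx_diag.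
  rewrite -[RHS]mul1mx -diag_const_mx diag_mx_pid; congr diag_mx.
  apply/rowP => i; rewrite !mxE; case: ltnP => ir; last by rewrite !mul0r mulr0.
  by rewrite !mul1r mulVf // gt_eqF // (ordered_svd_gt0 svdB) // (leq_trans ir).
rewrite -[leqLHS](rank_pid_mx R rk rk) -[X in (\rank X <= _)%N]E.
exact: leq_trans (mxrankM_maxl _ _) (mxrankM_maxr _ _).
Qed.

Lemma idempotent_compl (R : pzRingType) k (M : 'M[R]_k) :
  M *m M = M -> (1%:M - M) *m (1%:M - M) = 1%:M - M.
Proof.
by move=> MM; rewrite mulmxBr mulmx1 mulmxBl mul1mx MM subrr subr0.
Qed.

(** The residual has an SVD with the same [U] and [V], its first [r] singular values being replaced
    by zero. *)
Lemma truncated_svd_residual (R : realType) p q k r (B : 'M[R]_(p, q))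
    (U : 'M[R]_(p, k)) (s : 'rV[R]_k) (V : 'M[R]_(q, k)) :
  is_svd B U s V ->
  \tr ((B - truncated_svd r U s V) *m
       (B - truncated_svd r U s V)^T) =
    \tr (B *m B^T) - \sum_(i < k | (i < r)%N) s 0 i ^+ 2.
Proof.
case=> UU VV _ eB; rewrite (trace_mul_tr_svd UU VV eB).
rewrite (@trace_mul_tr_svd _ _ _ _ U (\row_i ((r <= i)%:R * s 0 i)) V) //.
  rewrite [X in X - _](bigID (fun i : 'I_k => i < r)%N) /=.
  rewrite addrC addrK [RHS]big_mkcond; apply: eq_bigr => i _.
  by rewrite mxE -leqNgt; case: leqP; rewrite ?mul1r ?mul0r ?expr0n.
rewrite truncated_svdE eB -mulmxBl -(mulmxA U) diag_mx_pid -mulmxBr.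
rewrite -raddfB; congr (_ *m diag_mx _ *m _); apply/rowP => i; rewrite !mxE.
by case: ltnP; rewrite ?mul1r ?mul0r ?subrr ?subr0.
Qed.

(** * Low-rank approximation and its equality case *)

(** Pythagoras for [B - Z = (B P - Z) + B (1 - P)], whose two summands have orthogonal row
    spaces. *)
Lemma projection_residual (R : realType) p q (B Z : 'M[R]_(p, q)) (P : 'M_q) :
  P^T = P -> P *m P = P -> Z *m P = Z ->
  \tr ((B - Z) *m (B - Z)^T) =
    \tr ((B *m P - Z) *m (B *m P - Z)^T) + \tr (B *m B^T)
      - \tr (B *m P *m B^T).
Proof.
move=> Psym Pidem ZP.
have PZ : P *m Z^T = Z^T by rewrite -{1}Psym -trmx_mul ZP.
rewrite -mxtraceD -raddfB /=; congr mxtrace.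
rewrite !linearB /= trmx_mul Psym !mulmxBl -!mulmxA PZ (mulmxA P) Pidem.
rewrite (mulmxA Z P) ZP.
by apply/matrixP => i j; rewrite !mxE; ring.
Qed.

(* The excess of the residual of Z over the optimum, as a sum of three terms
   that are nonnegative when s is non-increasing and \rank Z <= i0.+1. *)
Lemma residual_excess (R : realType) p q k (i0 : 'I_k) (B Z : 'M[R]_(p, q))
    (U : 'M[R]_(p, k)) (s : 'rV[R]_k) (V : 'M[R]_(q, k)) (P : 'M_q)
    (Q := P *m (1%:M - V *m V^T)) (W := V^T *m P *m V) (tau := s 0 i0) :
  is_svd B U s V ->
  P^T = P -> P *m P = P -> Z *m P = Z ->
  \tr ((B - Z) *m (B - Z)^T) =
    \tr (B *m B^T) - (\sum_(i < k | (i < i0.+1)%N) s 0 i ^+ 2)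
    + (\tr ((B *m P - Z) *m (B *m P - Z)^T)
       + \sum_i (s 0 i ^+ 2 - tau ^+ 2) * ((i < i0.+1)%:R - W i i)
       + tau ^+ 2 * (i0.+1%:R - \tr P + \tr (Q *m Q^T))).
Proof.
move=> [UU VV s_ge0 eB] Psym Pidem ZP.
rewrite (projection_residual B Psym Pidem ZP).
have -> : \tr (B *m P *m B^T) = \sum_i s 0 i ^+ 2 * W i i.
  rewrite {1 2}eB !trmx_mul trmxK tr_diag_mx !mulmxA mxtrace_mulC !mulmxA UU.
  rewrite mul1mx -!mulmxA (mulmxA V^T) (mulmxA _ V) -/W mulmxA.
  by apply: eq_bigr => i _; rewrite mul_mx_diag mul_diag_mx !mxE; ring.
(* [1 - V V^T] is a projection, so [Q] measures how far the range of [P] leaves the column span of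
   [V]. *)
have -> : \tr (Q *m Q^T) = \tr P - \tr W.
  rewrite /Q trmx_mul Psym [(_ - _)^T]linearB /= trmx1 trmx_mul trmxK.
  have V1 : (1%:M - V *m V^T) *m (1%:M - V *m V^T) = 1%:M - V *m V^T.
    by rewrite idempotent_compl // mulmxA -(mulmxA V) VV mulmx1.
  rewrite mulmxA -(mulmxA P) V1 mxtrace_mulC mulmxA Pidem mulmxBr mulmx1.
  by rewrite linearB /= mulmxA mxtrace_mulC mulmxA.
have ik : (i0 < k)%N by exact: ltn_ord.
have -> : i0.+1%:R = \sum_(i < k) (i < i0.+1)%:R :> R.
  rewrite -(trace_pid_mx _ ik); apply: eq_bigr => i _.
  by rewrite mxE eqxx.
(* Termwise identity, obtained by splitting [s_i^2] as [(s_i^2 - tau^2) + tau^2]. *)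
have -> : \sum_i s 0 i ^+ 2 * W i i =
    \sum_(i < k | (i < i0.+1)%N) s 0 i ^+ 2
    - \sum_i (s 0 i ^+ 2 - tau ^+ 2) * ((i < i0.+1)%:R - W i i)
    - tau ^+ 2 * (\sum_(i < k) (i < i0.+1)%:R - \tr W).
  rewrite mulrBr /mxtrace !mulr_sumr [X in _ = X - _ - _]big_mkcond.
  rewrite -!sumrB /=; apply: eq_bigr => i _.
  by case: (i < i0.+1)%N => /=; ring.
by ring.
Qed.

(** The bound [r <= \rank B] makes [tau], the smallest retained singular value, positive. In the
    equality case this forces [\rank Z = r] and [Q = 0]. *)
Lemma eckart_young (R : realType) p q k r (B Z : 'M[R]_(p, q))
    (U : 'M[R]_(p, k)) (s : 'rV[R]_k) (V : 'M[R]_(q, k))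
    (opt := \tr (B *m B^T) - \sum_(i < k | (i < r)%N) s 0 i ^+ 2) :
  is_ordered_svd B U s V -> (0 < r)%N -> (r <= \rank B)%N -> (\rank Z <= r)%N ->
  opt <= \tr ((B - Z) *m (B - Z)^T) /\
  (\tr ((B - Z) *m (B - Z)^T) <= opt ->
   exists U' V', is_ordered_svd B U' s V' /\ Z = truncated_svd r U' s V').
Proof.
move=> svdB r_gt0 rB Zr; have [[UU VV s_ge0 eB] s_le] := svdB.
have rk : (r <= k)%N.
  apply: leq_trans rB _; rewrite eB -mulmxA.
  exact: leq_trans (mxrankM_maxl _ _) (rank_leq_col _).
have i0P : (r.-1 < k)%N by rewrite prednK.
pose i0 := Ordinal i0P; set tau := s 0 i0.
have tau_gt0 : 0 < tau by rewrite (ordered_svd_gt0 svdB) //= prednK.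
have [P [Psym Pidem ZP trP]] := row_space_projection Z.
set W := V^T *m P *m V; set Q := P *m (1%:M - V *m V^T).
have w_ge0 i : 0 <= W i i.
  have -> : W = (P *m V)^T *m (P *m V).
    by rewrite trmx_mul Psym -mulmxA (mulmxA P) Pidem /W mulmxA.
  exact: gram_diag_ge0.
have w_le1 i : W i i <= 1.
  have E : 1%:M - W = ((1%:M - P) *m V)^T *m ((1%:M - P) *m V).
    rewrite trmx_mul [(_ - _)^T]linearB /= trmx1 Psym -mulmxA.
    rewrite (mulmxA (1%:M - P)) idempotent_compl // mulmxBl mul1mx mulmxBr VV.
    by rewrite /W mulmxA.
  have := gram_diag_ge0 ((1%:M - P) *m V) i; rewrite -E !mxE eqxx.
  by rewrite subr_ge0.
(* The two factors never have opposite signs: below [r], [s_i >= tau] and [w_i <= 1]; from [r] on,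
   [s_i <= tau] and [w_i >= 0]. *)
have g_ge0 i : 0 <= (s 0 i ^+ 2 - tau ^+ 2) * ((i < r)%:R - W i i).
  case: (ltnP i r) => ir.
    rewrite mulr_ge0 ?subr_ge0 ?w_le1 // ler_sqr ?nnegrE ?s_ge0 //.
    by rewrite s_le //= -ltnS prednK.
  rewrite mulr_le0 ?subr_le0 ?w_ge0 // ler_sqr ?nnegrE ?s_ge0 //.
  by rewrite s_le //= (leq_trans _ ir) // leq_pred.
have excess := residual_excess i0 svdB.1 Psym Pidem ZP.
have i0E : i0.+1 = r := prednK r_gt0.
rewrite i0E -/tau -/Q -/W -/opt trP in excess.
set dZ := \tr ((B *m P - Z) *m _) in excess.
set dQ := \tr (Q *m _) in excess.
set G := \sum_i (_ - _) * _ in excess.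
have dZ_ge0 : 0 <= dZ by exact: trace_mul_tr_ge0.
have dQ_ge0 : 0 <= dQ by exact: trace_mul_tr_ge0.
have G_ge0 : 0 <= G by exact: sumr_ge0.
have rZ_ge0 : 0 <= r%:R - (\rank Z)%:R :> R by rewrite subr_ge0 ler_nat.
have tau2 : 0 < tau ^+ 2 by rewrite exprn_gt0.
have last_ge0 : 0 <= tau ^+ 2 * (r%:R - (\rank Z)%:R + dQ).
  by rewrite mulr_ge0 ?(ltW tau2) // addr_ge0.
rewrite excess; split; first by rewrite lerDl !addr_ge0.
rewrite gerDl => sum0.
have dZ0 : dZ = 0 by lra.
have G0 : G = 0 by lra.
have /eqP : tau ^+ 2 * (r%:R - (\rank Z)%:R + dQ) = 0 by lra.
rewrite mulf_eq0 gt_eqF //= => /eqP delta0.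
have dQ0 : dQ = 0 by lra.
have trP' : \tr P = r%:R by rewrite trP; lra.
have BP : Z = B *m P.
  by apply/esym/eqP; rewrite -subr_eq0; apply/eqP/trace_mul_tr_eq0.
(* With [Q = 0], the range of [P] lies in the column span of [V], so compressing [P] to [W] loses
   nothing. *)
have PVV : P *m V *m V^T = P.
  apply/esym/eqP; rewrite -subr_eq0; apply/eqP.
  by rewrite -{1}[P]mulmx1 -mulmxA -mulmxBr; exact: trace_mul_tr_eq0 dQ0.
have Wsym : W^T = W by rewrite !trmx_mul trmxK Psym mulmxA.
have Widem : W *m W = W.
  rewrite {1 2}/W !mulmxA -(mulmxA V^T P) -(mulmxA V^T) PVV.
  by rewrite -(mulmxA V^T P) Pidem.
have trW : \tr W = r%:R by rewrite mxtrace_mulC mulmxA mxtrace_mulC mulmxA PVV.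
pose nu := \row_i (s 0 i - tau).
have nuW : diag_mx nu *m W = diag_mx nu *m pid_mx r.
  apply/matrixP => i j; rewrite !mul_diag_mx [LHS]mxE [RHS]mxE.
  rewrite [nu 0 i]mxE [pid_mx r i j]mxE.
  have [->|nui] := eqVneq (s 0 i) tau; first by rewrite subrr !mul0r.
  have wi : W i i = (i < r)%:R.
    have /eqP := psumr_eq0P (fun l _ => g_ge0 l) G0 (i := i) isT.
    rewrite mulf_eq0 !subr_eq0 eqrXn2 ?s_ge0 ?ltW // (negPf nui).
    by move/eqP.
  congr (_ * _).
  (* The diagonal of [W W^T = W] gives [w_i] as the sum of the squares in row [i]. As [w_i] is 0 or
     1, it equals its own square, leaving nothing off the diagonal. *)
  have Wij : \sum_(l | l != i) W i l ^+ 2 = 0.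
    have : (W *m W^T) i i = W i i by rewrite Wsym Widem.
    rewrite mxE (bigD1 i) //= [W^T i i]mxE wi.
    under eq_bigr => l _ do rewrite [W^T l i]mxE -expr2.
    by case: (i < r)%N; rewrite ?mulr1 ?mulr0 => /eqP;
       rewrite -subr_eq0 addrAC ?subrr ?subr0 add0r => /eqP.
  have [<-|ij] := eqVneq i j; first by rewrite wi eqxx.
  rewrite val_eqE (negPf ij) /=; apply/eqP; rewrite -sqrf_eq0; apply/eqP.
  by apply: (psumr_eq0P _ Wij) => [l _|]; rewrite ?sqr_ge0 // eq_sym.
have nu0 (i j : 'I_k) : (i <= j)%N -> (j < r)%N -> nu 0 i = 0 -> nu 0 j = 0.
  rewrite !mxE => ij jr /eqP; rewrite subr_eq0 => /eqP si; apply/eqP.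
  by rewrite subr_eq0 eq_le -{1}si s_le //= s_le //= -ltnS prednK.
have [T [TT NT WT]] := projection_diagonalization rk Wsym Widem trW nu0 nuW.
have TTt : T *m T^T = 1%:M by apply/mulmx1C.
have eD : diag_mx s = diag_mx nu + tau%:M.
  by apply/matrixP => i j; rewrite !mxE -mulrnDl subrK.
(* [diag_mx s] differs from [diag_mx nu] by a scalar matrix, and [T] fixes [diag_mx nu] on both
   sides. *)
have TD : T *m diag_mx s = diag_mx s *m T.
  rewrite eD mulmxDl mulmxDr NT scalar_mxC; congr (_ + _).
  rewrite -{2}[diag_mx nu]mul1mx -TTt -mulmxA; congr (_ *m _).
  by rewrite -{2}tr_diag_mx -trmx_mul NT tr_diag_mx.
exists (U *m T), (V *m T); split; last first.
  rewrite truncated_svdE -(mulmxA U) TD BP eB -{1}PVV !trmx_mul.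
  rewrite -!(mulmxA U) -!mulmxA; do 2!congr (_ *m _).
  by rewrite !mulmxA -/W WT.
split => //; split; rewrite ?trmx_mul //.
- by rewrite mulmxA -(mulmxA _ U^T) UU mulmx1.
- by rewrite mulmxA -(mulmxA _ V^T) VV mulmx1.
- by rewrite !mulmxA -(mulmxA U) TD mulmxA -(mulmxA _ T) TTt mulmx1.
Qed.

(** * Reduction of the objective and description of the minimizers *)

Lemma orthonormal_square (R : comNzRingType) m k (U : 'M[R]_(m, k)) :
  k = m -> U^T *m U = 1%:M -> U *m U^T = 1%:M.
Proof. by move=> e; subst m; apply: mulmx1C. Qed.

(** The product [alpha beta^T C] equals [- Z V^T], so only the component of [S^T Rs] in the span of
    [V] can be altered; the rest contributes a constant. *)
Lemma objectiveE (R : realType) d ms m N r k (S : 'M[R]_(d, ms))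
    (Rs : 'M[R]_(d, N)) (C : 'M[R]_(m, N)) (U : 'M[R]_(m, k)) (s : 'rV[R]_k)
    (V : 'M[R]_(N, k)) (ab : 'M[R]_(ms, r) * 'M[R]_(m, r))
    (B := S^T *m Rs *m V) (Z := - (ab.1 *m ab.2^T *m U *m diag_mx s)) :
  is_svd C U s V ->
  objective S Rs C ab =
    \tr (S^T *m Rs *m (S^T *m Rs)^T) - \tr (B *m B^T)
    + \tr ((B - Z) *m (B - Z)^T).
Proof.
case=> UU VV _ ->; rewrite /objective frobenius_norm_sqr.
have expand (A : 'M[R]_(ms, N)) (Y : 'M[R]_(ms, k)) :
    \tr ((A + Y *m V^T) *m (A + Y *m V^T)^T) =
    \tr (A *m A^T) - \tr (A *m V *m (A *m V)^T)
    + \tr ((A *m V + Y) *m (A *m V + Y)^T).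
  rewrite [(A + _)^T]linearD [(_ + Y)^T]linearD /= !trmx_mul trmxK.
  rewrite !mulmxDl !mulmxDr !mulmxA -(mulmxA Y V^T V) VV mulmx1.
  rewrite -raddfB -raddfD; congr mxtrace.
  by apply/matrixP => i j; rewrite !mxE; ring.
by rewrite opprK !mulmxA expand.
Qed.

(** The objective sees [alpha beta^T] only through its product with [Cs], so minimizers are compared
    after that multiplication, and directly when [rC = m]. Ties among singular values allow several
    truncations, whence the existential [U'] and [V']. *)
Theorem proposition1 (R : realType) (d m ms n p : nat)
  (hd : (0 < d)%N) (hm : (0 < m)%N) (hms : (0 < ms)%N)
  (hn : (0 < n)%N) (hp : (0 < p)%N)
  (hm_ms : (m <= ms)%N) (hms_d : (ms <= d)%N)
  (idx : 'I_ms -> 'I_d) (idx_inj : injective idx)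
  (S : 'M[R]_(d, ms)) (hS : S = selection_mx R idx)
  (Rs : 'M[R]_(d, (2 * n * p)%N)) (Cs : 'M[R]_(m, (2 * n * p)%N))
  (rC : nat) (hrC : rC = \rank Cs)
  (U : 'M[R]_(m, rC)) (s : 'rV[R]_rC) (V : 'M[R]_((2 * n * p)%N, rC))
  (hC : is_compact_svd Cs U s V)
  (r : nat) (hr1 : (1 <= r)%N)
  (hr : (r <= \rank (S^T *m Rs *m V))%N)
  (hrk : (\rank (S^T *m Rs *m V) <= rC)%N) :
  let Sigma := diag_mx s in
  let B := S^T *m Rs *m V in
  let O := @objective R d ms m (2 * n * p)%N r S Rs Cs in
  let Vr := @rank_pairs R ms m r in
  (forall (k : nat) (Ub : 'M[R]_(ms, k)) (sb : 'rV[R]_k) (Vb : 'M[R]_(rC, k)),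
     is_ordered_svd B Ub sb Vb ->
     let sol (U' : 'M[R]_(ms, k)) (V' : 'M[R]_(rC, k)) :=
       - truncated_svd r U' sb V' *m invmx Sigma *m U^T in
     [/\ exists2 ab, Vr ab & ab.1 *m ab.2^T = sol Ub Vb,
         forall ab, Vr ab -> ab.1 *m ab.2^T = sol Ub Vb -> is_argmin Vr O ab,
         forall ab, is_argmin Vr O ab ->
           exists (U' : 'M[R]_(ms, k)) (V' : 'M[R]_(rC, k)),
             [/\ is_ordered_svd B U' sb V',
                 ab.1 *m ab.2^T *m Cs = sol U' V' *m Cs
               & rC = m -> ab.1 *m ab.2^T = sol U' V']
       & is_min_value Vr O
           (frobenius_norm (S^T *m Rs) ^+ 2
            - \sum_(i < k | (i < r)%N) sb 0 i ^+ 2)])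
  /\
  (r = \rank B ->
     forall Cd : 'M[R]_((2 * n * p)%N, m), is_pinv Cs Cd ->
     [/\ exists2 ab, Vr ab & ab.1 *m ab.2^T = - (S^T *m Rs *m Cd),
         forall ab, Vr ab -> ab.1 *m ab.2^T = - (S^T *m Rs *m Cd) ->
           is_argmin Vr O ab,
         forall ab, is_argmin Vr O ab ->
           ab.1 *m ab.2^T *m Cs = - (S^T *m Rs *m Cd) *m Cs
           /\ (rC = m -> ab.1 *m ab.2^T = - (S^T *m Rs *m Cd))
       & is_min_value Vr O
           (frobenius_norm (S^T *m Rs) ^+ 2 - frobenius_norm B ^+ 2)]).
Proof.
move=> Sigma B O Vr; have [svdC s_gt0] := hC; have [UU VV _ eC] := svdC.
have Su : Sigma \in unitmx.
  rewrite unitmxE det_diag unitfE; apply/prodf_neq0 => i _.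
  by rewrite gt_eqF.
(* [X] is a right inverse of this change of variables. It is also a left inverse when [U] is square,
   and otherwise only after multiplication by [Cs]. *)
pose Z (ab : 'M[R]_(ms, r) * 'M[R]_(m, r)) := - (ab.1 *m ab.2^T *m U *m Sigma).
pose A := S^T *m Rs; pose X (M : 'M[R]_(ms, rC)) := - M *m invmx Sigma *m U^T.
have OE ab : O ab = \tr (A *m A^T) - \tr (B *m B^T)
    + \tr ((B - Z ab) *m (B - Z ab)^T).
  exact: objectiveE.
have rankZ ab : (\rank (Z ab) <= r)%N.
  rewrite mxrank_opp -!mulmxA; apply: leq_trans (mxrankM_maxl _ _) _.
  exact: rank_leq_col.
have ZX ab M : ab.1 *m ab.2^T = X M -> Z ab = M.
  rewrite /Z => ->; rewrite /X -(mulmxA _ U^T) UU mulmx1 mulmxKV //.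
  by rewrite opprK.
have XC M : X M *m Cs = - M *m V^T.
  by rewrite eC /X !mulmxA -(mulmxA _ U^T U) UU mulmx1 mulmxKV.
have abC ab : ab.1 *m ab.2^T *m Cs = X (Z ab) *m Cs.
  by rewrite XC /Z opprK eC !mulmxA.
have abX ab : rC = m -> ab.1 *m ab.2^T = X (Z ab).
  move=> /orthonormal_square/(_ UU) UUt.
  by rewrite /X /Z opprK mulmxK // -mulmxA UUt mulmx1.
have ex_ab M : \rank M = r -> exists2 ab, Vr ab & ab.1 *m ab.2^T = X M.
  move=> rM; apply: rank_factorization; apply/eqP; rewrite eqn_leq.
  apply/andP; split.
    rewrite /X -mulmxA; apply: leq_trans (mxrankM_maxl _ _) _.
    by rewrite mxrank_opp rM.
  (* [M] is recovered from [X M] up to sign, so the rank does not drop. *)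
  have E : X M *m U *m Sigma = - M.
    by rewrite /X -(mulmxA _ U^T) UU mulmx1 mulmxKV.
  rewrite -rM -mxrank_opp -E -mulmxA; exact: mxrankM_maxl.
split=> [k Ub sb Vb svdB sol|rB Cd pinvCd].
  have tr_opt ab : Vr ab -> ab.1 *m ab.2^T = sol Ub Vb ->
      O ab = frobenius_norm A ^+ 2 - \sum_(i < k | (i < r)%N) sb 0 i ^+ 2.
    move=> _ /ZX eZ; rewrite OE eZ truncated_svd_residual; last exact: svdB.1.
    by rewrite frobenius_norm_sqr addrA subrK.
  have lower ab : frobenius_norm A ^+ 2 - \sum_(i < k | (i < r)%N) sb 0 i ^+ 2
      <= O ab.
    have [+ _] := eckart_young svdB hr1 hr (rankZ ab).
    by rewrite OE frobenius_norm_sqr; lra.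
  have [ab0 Vab0 eab0] := ex_ab _ (rank_truncated_svd svdB hr).
  have argmin ab : Vr ab -> ab.1 *m ab.2^T = sol Ub Vb -> is_argmin Vr O ab.
    by move=> Vab eab; split=> // ab' _; rewrite (tr_opt ab).
  split=> //; first by exists ab0.
  - move=> ab [Vab /(_ ab0 Vab0)]; rewrite (tr_opt ab0) // => Oab.
    have [_ []] := eckart_young svdB hr1 hr (rankZ ab).
      by move: Oab; rewrite OE frobenius_norm_sqr; lra.
    move=> U' [V' [svdB' eZ]]; exists U', V'; rewrite /sol -eZ; split=> //.
    exact: abX.
  - by exists ab0; [exact: argmin | rewrite (tr_opt ab0)].
have eX : - (S^T *m Rs *m Cd) = X B.
  rewrite (pinv_unique pinvCd (compact_svd_pinv hC)) /X /B !mulNmx.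
  by rewrite !mulmxA.
(* For [r = \rank B] the value [Z ab = B] is attainable, so the residual can vanish and no
   truncation is involved. *)
rewrite eX; have OZ ab : Z ab = B -> O ab =
    frobenius_norm A ^+ 2 - frobenius_norm B ^+ 2.
  by move=> eZ; rewrite OE eZ subrr mul0mx mxtrace0 addr0 !frobenius_norm_sqr.
have lower ab : frobenius_norm A ^+ 2 - frobenius_norm B ^+ 2 <= O ab.
  by rewrite OE !frobenius_norm_sqr lerDl trace_mul_tr_ge0.
have [ab0 Vab0 eab0] := ex_ab _ (esym rB).
have argmin ab : Vr ab -> ab.1 *m ab.2^T = X B -> is_argmin Vr O ab.
  by move=> Vab /ZX eZ; split=> // ab' _; rewrite (OZ ab).
split=> //; first by exists ab0.
- move=> ab [Vab /(_ ab0 Vab0)]; rewrite (OZ ab0 (ZX _ _ eab0)) => Oab.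
  have eZ : Z ab = B.
    apply/esym/eqP; rewrite -subr_eq0; apply/eqP/trace_mul_tr_eq0/le_anti.
    rewrite trace_mul_tr_ge0 andbT.
    by move: Oab; rewrite OE !frobenius_norm_sqr; lra.
  by rewrite -{1 2}eZ; split; [exact: abC | exact: abX].
- by exists ab0; [exact: argmin | rewrite (OZ ab0 (ZX _ _ eab0))].
Qed.
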